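(* Let $A_1,\dots,A_m$ be real $n\times n$ matrices that leave a proper cone invariant, i.e. there exists a proper cone $K\subseteq\mathbb{R}^n$ with $A_iK\subseteq K$ for all $i$. Then for every integer $k\ge 1$ $$\frac{1}{m^{1/k}}\,\rho\big(A_1^{\otimes k}+\cdots+A_m^{\otimes k}\big)^{1/k}\;\le\;\rho(A_1,\dots,A_m)\;\le\;\rho\big(A_1^{\otimes k}+\cdots+A_m^{\otimes k}\big)^{1/k}.$$ In particular, $$\rho(A_1,\dots,A_m)=\lim_{k\to\infty}\rho\big(A_1^{\otimes k}+\cdots+A_m^{\otimes k}\big)^{1/k}.$$
   Context: For a single real square matrix $A$, $\rho(A)=\lim_{k\to\infty}\|A^k\|^{1/k}$ is the spectral radius (the largest modulus of an eigenvalue). For a finite set of real $n\times n$ matrices the joint spectral radius is $$\rho(A_1,\dots,A_m)=\limsup_{k\to+\infty}\ \max_{\sigma\in\{1,\dots,m\}^k}\|A_\sigma\|^{1/k},\qquad A_\sigma=A_{\sigma_k}\cdots A_{\sigma_2}A_{\sigma_1},$$ where $\|\cdot\|$ is any matrix norm (the value does not depend on the choice). A cone in $\mathbb{R}^n$ is a subset $K\subseteq\mathbb{R}^n$ such that $\lambda v\in K$ for all $\lambda\ge 0$ and $v\in K$; a cone is proper if it is closed, convex, has nonempty interior, and contains no straight line. $A^{\otimes k}=A\otimes\cdots\otimes A$ ($k$ factors) denotes the $k$-th Kronecker power, where $A\otimes B$ is the Kronecker product (block matrix with blocks $A_{ij}B$). *)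

(* Defs.v *)
From mathcomp Require Import all_boot all_order all_algebra.
From mathcomp Require Import all_classical all_reals all_analysis.
From mathcomp Require Export mxtens.

Set Implicit Arguments.
Unset Strict Implicit.
Unset Printing Implicit Defensive.

Import Order.TTheory GRing.Theory Num.Theory.
Import numFieldNormedType.Exports.

Local Open Scope classical_set_scope.
Local Open Scope ring_scope.

(* Both radii below are independent of the choice of the norm; the one used is
   the library's norm on matrices, the largest modulus of an entry.  The terms
   of index 0 of the sequences are irrelevant. *)

Definition spectral_radius (R : realType) (n : nat) (A : 'M[R]_n) : R :=
  limn (fun k : nat => `|A ^+ k| `^ k%:R^-1).

(* With s = (s_1, ..., s_k), this is A_{s_k} * ... * A_{s_2} * A_{s_1}: the
   product is taken from left to right, hence the reversal of the indices. *)
Definition word_prod (R : realType) (n m : nat) (A : 'I_m -> 'M[R]_n)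
    (k : nat) (s : k.-tuple 'I_m) : 'M[R]_n :=
  \prod_(i < k) A (tnth s (rev_ord i)).

(* The terms of the maximum are nonnegative, so the default value 0 does not
   affect it. *)
Definition joint_spectral_radius (R : realType) (n m : nat)
    (A : 'I_m -> 'M[R]_n) : R :=
  limn_sup (fun k : nat =>
    \big[Num.max/0]_(s : k.-tuple 'I_m) (`|word_prod A s| `^ k%:R^-1)).

Definition cone (R : realType) (n : nat) (K : set 'cV[R]_n) : Prop :=
  forall (a : R) (v : 'cV[R]_n), 0 <= a -> K v -> K (a *: v).

Definition contains_line (R : realType) (n : nat) (K : set 'cV[R]_n) : Prop :=
  exists x d : 'cV[R]_n, d != 0 /\ forall t : R, K (x + t *: d).

Definition proper_cone (R : realType) (n : nat) (K : set 'cV[R]_n) : Prop :=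
  [/\ cone K, closed K, @convex_set R 'cV[R]_n K, K° !=set0
    & ~ contains_line K].

Definition kron_power_sum (R : realType) (n m : nat) (A : 'I_m -> 'M[R]_n)
    (k : nat) : 'M[R]_(n ^ k) :=
  \sum_(i < m) A i ^t k.

(* Main.v *)
Require Import Defs.
From mathcomp Require Import all_boot all_order all_algebra.
From mathcomp Require Import all_classical all_reals all_analysis.
From mathcomp Require Import ring lra.

Import Order.TTheory GRing.Theory Num.Theory.
Import numFieldNormedType.Exports.

Local Open Scope classical_set_scope.
Local Open Scope ring_scope.

Set Implicit Arguments.
Unset Strict Implicit.
Unset Printing Implicit Defensive.

(** Write S for the sum of the k-th Kronecker powers of the A i.  Since the
Kronecker power is multiplicative, S ^+ t is the sum, over all words s of
length t, of the k-th Kronecker powers of the products A_s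
([kron_power_sum_expr]).  Both inequalities compare |S ^+ t| with the largest
|A_s| ^ k and then take t-th roots.

The lower bound on the joint spectral radius is the triangle inequality: there
are m ^ t words and the Kronecker power does not increase the largest entry
beyond its k-th power, so |S ^+ t| is at most m ^ t times the largest
|A_s| ^ k.

The upper bound needs that the terms of the sum do not cancel, and this is where
the cone enters.  A proper cone K has an interior point x, and a linear form l
that dominates the norm on K; together they dominate the norm of every matrix
B that preserves K: |B| <= c * (l B x) ([cone_norm_bound]).  Hence
|A_s| ^ k <= c ^ k * (l A_s x) ^ k, and (l A_s x) ^ k is the entry obtained by
applying the k-th powers of l and x to that of A_s.  All these numbers are
nonnegative, so each is at most their sum over s, which is a fixed linear
function of S ^+ t.  Therefore |A_s| ^ k <= C * |S ^+ t| with C independent of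
t and s ([norm_word_prod_le_kron]), and C ^ (1/t) tends to 1.

The form l is a sum of forms that are nonnegative on K and span the dual
space.  Such forms exist because a vector x killed by all forms nonnegative on K
would have x and -x in K, by separation of a point from a closed convex cone,
and then K would contain a line ([dual_cone_spans]).

The spectral radius is a limit, and it exists by Fekete's argument for
submultiplicative sequences ([cvg_root_submultiplicative]).  The final
convergence is a squeeze, since m ^ (1/k) tends to 1. *)

(** * Roots *)

Lemma ler_root (R : realType) (a b : R) (k : nat) :
  0 <= a -> a <= b -> a `^ k%:R^-1 <= b `^ k%:R^-1.
Proof.
by move=> a0 ab; rewrite ge0_ler_powR ?nnegrE ?invr_ge0 // (le_trans a0).
Qed.

Lemma powR_root_exp (R : realType) (a : R) (k : nat) :
  0 <= a -> (a `^ k.+1%:R^-1) ^+ k.+1 = a.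
Proof.
by move=> a0; rewrite -powR_mulrn ?powR_ge0 // -powRrM mulVf ?pnatr_eq0 // powRr1.
Qed.

Lemma powR_exp_root (R : realType) (a : R) (k : nat) :
  0 <= a -> (a ^+ k.+1) `^ k.+1%:R^-1 = a.
Proof.
by move=> a0; rewrite -powR_mulrn // -powRrM mulfV ?pnatr_eq0 // powRr1.
Qed.

Lemma cvg_powR_inv (R : realType) (c : R) : 0 < c ->
  c `^ k%:R^-1 @[k --> \oo] --> (1 : R).
Proof.
move=> c0; rewrite -cvg_shiftS /=.
have -> : (fun k : nat => c `^ k.+1%:R^-1) =
    (fun k : nat => expR (k.+1%:R^-1 * ln c)).
  by apply/funext => k; rewrite /powR gt_eqF.
have : k.+1%:R^-1 * ln c @[k --> \oo] --> 0 * ln c.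
  by apply: cvgMr_tmp; exact: cvg_harmonic.
rewrite mul0r -(@expR0 R) => /continuous_cvg; apply.
exact: continuous_expR.
Qed.

(** * The largest entry and Kronecker powers *)

Lemma entry_le_norm (R : realType) (p q : nat) (B : 'M[R]_(p, q)) i j :
  `|B i j| <= `|B|.
Proof.
rewrite [leRHS]mx_normrE.
exact: (le_bigmax_cond _ (fun ij => `|B ij.1 ij.2|) (j := (i, j))).
Qed.

Lemma norm_le_entries (R : realType) (p q : nat) (B : 'M[R]_(p, q)) (c : R) :
  0 <= c -> (forall i j, `|B i j| <= c) -> `|B| <= c.
Proof.
move=> c0 Bc; rewrite [leLHS]mx_normrE.
by apply: bigmax_le => // -[i j] _; exact: Bc.
Qed.

Lemma norm_mulmx_le (R : realType) (p q r : nat) (B : 'M[R]_(p, q))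
    (C : 'M[R]_(q, r)) : `|B *m C| <= q%:R * `|B| * `|C|.
Proof.
apply: norm_le_entries => [|i j]; first by rewrite !mulr_ge0.
rewrite mxE; apply: (le_trans (ler_norm_sum _ _ _)).
rewrite -mulrA mulr_natl -[X in _ *+ X]card_ord -sumr_const.
by apply: ler_sum => l _; rewrite normrM ler_pM ?entry_le_norm.
Qed.

Lemma norm_tensmx_le (R : realType) (p q r s : nat) (B : 'M[R]_(p, q))
    (C : 'M[R]_(r, s)) : `|B *t C| <= `|B| * `|C|.
Proof.
apply: norm_le_entries => [|i j]; first by rewrite mulr_ge0.
by rewrite mxE normrM ler_pM ?entry_le_norm.
Qed.

(** The exponent is a successor here and below because the Kronecker power is
built by recursion from exponent 1, with exponent 0 treated apart. *)
Lemma norm_ntensmx_le (R : realType) (p q k : nat) (B : 'M[R]_(p, q)) :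
  `|B ^t k.+1| <= `|B| ^+ k.+1.
Proof.
elim: k => [|k IH]; first by rewrite ntensmx1 expr1.
rewrite ntensmxSS exprS; apply: (le_trans (norm_tensmx_le _ _)).
by rewrite ler_wpM2l.
Qed.

Lemma ntensmx_mul (R : comPzRingType) (p q r k : nat) (B : 'M[R]_(p, q))
    (C : 'M[R]_(q, r)) : (B *m C) ^t k.+1 = B ^t k.+1 *m C ^t k.+1.
Proof. by elim: k => [//|k IH]; rewrite !ntensmxSS IH tensmx_mul. Qed.

Lemma tensmx11 (R : pzRingType) (p q : nat) :
  (1%:M : 'M[R]_p) *t (1%:M : 'M[R]_q) = 1%:M.
Proof.
apply/matrixP => i j.
case: (mxtens_indexP i) => i0 i1; case: (mxtens_indexP j) => j0 j1.
rewrite tensmxE !mxE -natrM mulnb; congr (_%:R).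
by rewrite (can_eq (@mxtens_indexK _ _)) xpair_eqE.
Qed.

Lemma ntensmx_1 (R : pzRingType) (p k : nat) :
  (1%:M : 'M[R]_p) ^t k.+1 = 1%:M.
Proof. by elim: k => [//|k IH]; rewrite ntensmxSS IH tensmx11. Qed.

(** Applied to a product l B x of a row, a square matrix and a column, this
makes the product of their Kronecker powers a power of that number. *)
Lemma ntensmx_dim1 (R : pzRingType) (k : nat) (B : 'M[R]_1) i j :
  (B ^t k.+1) i j = B 0 0 ^+ k.+1.
Proof.
elim: k i j => [|k IH] i j; first by rewrite expr1 ntensmx1 (ord1 (i : 'I_1)) (ord1 (j : 'I_1)).
by rewrite ntensmxSS mxE IH (ord1 (_ i).1) (ord1 (_ j).1) [RHS]exprS.
Qed.

(** * Powers of a sum of Kronecker powers *)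

(** The reversal of the indices makes the first letter of a word the rightmost
factor, so the induction peels the last factor of the power off as the head of
the tuple. *)
Lemma expr_sum_words (S : pzRingType) (m k : nat) (B : 'I_m -> S) :
  (\sum_(i < m) B i) ^+ k =
  \sum_(s : k.-tuple 'I_m) \prod_(i < k) B (tnth s (rev_ord i)).
Proof.
elim: k => [|k IH].
  rewrite expr0 (bigD1 [tuple]) //= big_ord0 big1 ?addr0 // => s.
  by case/negP; apply/eqP; rewrite [s]tuple0.
rewrite exprSr IH mulr_suml.
under eq_bigr do rewrite mulr_sumr.
rewrite pair_bigA /=.
rewrite (reindex (fun u : k.-tuple 'I_m * 'I_m => [tuple of u.2 :: u.1])) /=.
  apply: eq_bigr => -[s j] _ /=; rewrite big_ord_recr /=; congr (_ * B _).
    apply: eq_bigr => i _; congr (B _).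
    have -> : rev_ord (widen_ord (leqnSn k) i) = lift ord0 (rev_ord i).
      apply: val_inj => /=; rewrite /bump /= add1n subSS.
      by rewrite subnSK.
    by rewrite tnthS.
  have -> : rev_ord (@ord_max k) = ord0 by apply: val_inj => /=; rewrite subnn.
  by rewrite tnth0.
exists (fun s : k.+1.-tuple 'I_m => ([tuple of behead s], thead s)).
  by move=> [s j] _ /=; congr (_, _); apply: val_inj.
by move=> s _ /=; rewrite [RHS]tuple_eta.
Qed.

Lemma kron_power_sum_expr (R : realType) (n m k t : nat)
    (A : 'I_m -> 'M[R]_n) :
  kron_power_sum A k.+1 ^+ t =
  \sum_(s : t.-tuple 'I_m) (word_prod A s) ^t k.+1.
Proof.
rewrite expr_sum_words; apply: eq_bigr => s _.
rewrite /word_prod (big_morph (fun B : 'M[R]_n => B ^t k.+1)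
  (id1 := 1) (op1 := *%R)) //.
- by move=> B C; exact: ntensmx_mul.
- exact: ntensmx_1.
Qed.

(** * Fekete's limit and upper limits *)

(** A single term below the geometric sequence of ratio c bounds the whole
sequence, up to a constant M: strip blocks of length s.+1 from the index until a
remainder below s.+1 is left, and let M absorb these finitely many
remainders. *)
Lemma submultiplicative_le_geom (R : realType) (b : nat -> R) (s : nat) (c : R) :
  (forall t, 0 <= b t) -> (forall p q, b (p + q)%N <= b p * b q) ->
  0 < c -> b s.+1 <= c ^+ s.+1 ->
  exists2 M : R, 0 < M & forall t, b t <= M * c ^+ t.
Proof.
move=> b0 bD c0 bs.
pose M := 1 + \sum_(i < s.+1) b i / c ^+ i.
have bc i : 0 <= b i / c ^+ i by rewrite mulr_ge0 // invr_ge0 exprn_ge0 // ltW.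
have M0 : 0 < M by rewrite ltr_wpDr // sumr_ge0.
exists M => // t.
elim/ltn_ind: t => t IH; have [ts|st] := ltnP t s.+1.
  rewrite -ler_pdivrMr ?exprn_gt0 // /M (bigD1 (Ordinal ts)) //=.
  by rewrite addrCA lerDl addr_ge0 // sumr_ge0.
rewrite -(subnKC st); apply: (le_trans (bD _ _)).
rewrite exprD mulrCA ler_pM // IH //.
by rewrite ltn_subrL /= (leq_trans _ st).
Qed.

(** The limit is the infimum of the roots: if the s-th root is below c, the
previous lemma bounds b t by M * c ^+ t, and the t-th root of M tends to 1. *)
Lemma cvg_root_submultiplicative (R : realType) (b : nat -> R) :
  (forall t, 0 <= b t) -> (forall p q, b (p + q)%N <= b p * b q) ->
  cvgn (fun t : nat => b t `^ t%:R^-1).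
Proof.
move=> b0 bD.
pose E := [set b t.+1 `^ t.+1%:R^-1 | t in [set: nat]].
have E0 : has_inf E.
  split; first by exists (b 1%N `^ 1%:R^-1); exists 0%N.
  by exists 0 => _ [t _ <-]; exact: powR_ge0.
apply/cvg_ex; exists (inf E); apply/cvgrPdist_le => e e0.
have [_ [s _ <-] sE] := inf_adherent (divr_gt0 e0 (ltr0n R 2)) E0.
set c := inf E + e / 2 in sE.
have c0 : 0 < c by apply: le_lt_trans sE; exact: powR_ge0.
have bs : b s.+1 <= c ^+ s.+1.
  rewrite -[leLHS](@powR_root_exp _ _ s) //.
  by rewrite ler_pXn2r // ?nnegrE ?powR_ge0 // ltW.
have [M M0 bM] := submultiplicative_le_geom b0 bD c0 bs.
have ce : c < inf E + e by rewrite /c ltrD2l ltr_pdivrMr // ltr_pMr // ltr1n.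
have Mc : M `^ t%:R^-1 * c @[t --> \oo] --> c.
  by rewrite -[X in _ --> X]mul1r; apply: cvgMr_tmp; exact: cvg_powR_inv.
have t_gt0 : \forall t \near \oo, (0 < t)%N by exists 1%N.
have tc := cvgr_le _ Mc _ ce.
near=> t.
have t0 : (0 < t)%N by near: t.
have tE : inf E <= b t `^ t%:R^-1.
  by apply: ge_inf; [exact: E0.2|exists t.-1; rewrite ?prednK].
rewrite distrC ger0_norm ?subr_ge0 // lerBlDl.
apply: (@le_trans _ _ (M `^ t%:R^-1 * c)); last by near: t; exact: tc.
have -> : c = (c ^+ t) `^ t%:R^-1 by rewrite -(prednK t0) powR_exp_root // ltW.
rewrite -powRM ?exprn_ge0 ?(ltW M0) ?(ltW c0) //.
exact: ler_root.
Unshelve. all: by end_near. Qed.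

(** The entrywise norm is submultiplicative only up to the factor n; n.+1 times
the norm is submultiplicative, and the t-th root of n.+1 tends to 1.  With n.+1
instead of n the factor is invertible even in dimension 0. *)
Lemma spectral_radius_cvg (R : realType) (n : nat) (B : 'M[R]_n) :
  (fun t : nat => `|B ^+ t| `^ t%:R^-1) @ \oo --> spectral_radius B.
Proof.
pose b t := n.+1%:R * `|B ^+ t|.
have b0 t : 0 <= b t by rewrite mulr_ge0.
have bD p q : b (p + q)%N <= b p * b q.
  rewrite /b exprD mulrACA -mulrA ler_wpM2l //.
  apply: (le_trans (norm_mulmx_le _ _)); rewrite -mulrA.
  by rewrite ler_wpM2r ?mulr_ge0 // ler_nat.
have /cvg_ex[l bl] := cvg_root_submultiplicative b0 bD.
have C0 : (0 : R) < n.+1%:R^-1 by rewrite invr_gt0 ltr0n.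
apply: (cvgP l).
have -> : (fun t : nat => `|B ^+ t| `^ t%:R^-1) =
    (fun t : nat => n.+1%:R^-1 `^ t%:R^-1 * b t `^ t%:R^-1).
  apply/funext => t; rewrite /b -powRM ?(ltW C0) ?mulr_ge0 // mulrA mulVf ?mul1r //.
by rewrite -[l]mul1r; apply: cvgM bl; exact: cvg_powR_inv.
Qed.

Lemma spectral_radius_ge0 (R : realType) (n : nat) (B : 'M[R]_n) :
  0 <= spectral_radius B.
Proof.
rewrite /spectral_radius; apply: limr_ge; first exact: (cvgP _ (@spectral_radius_cvg _ _ B)).
by apply: nearW => t; exact: powR_ge0.
Qed.

(** The boundedness is part of the conclusion because the upper limit of an
unbounded sequence is a junk value, and the next two lemmas need it. *)
Lemma limn_sup_le_near (R : realType) (u : nat -> R) (c : R) :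
  (forall t, 0 <= u t) -> (\forall t \near \oo, u t <= c) ->
  has_ubound (range u) /\ limn_sup u <= c.
Proof.
move=> u0 uc; have [N _ Nc] := uc.
have ub : has_ubound (range u).
  exists (`|c| + \sum_(i < N) u i) => _ [t _ <-].
  have [tN|Nt] := ltnP t N.
    by rewrite (bigD1 (Ordinal tN)) //= addrCA lerDl addr_ge0 // sumr_ge0.
  by rewrite (le_trans (Nc t Nt)) // (le_trans (ler_norm c)) // lerDl sumr_ge0.
have lb : has_lbound (range u) by exists 0 => _ [t _ <-].
split=> //; apply: limr_le; first exact: (cvgP _ (cvg_sups_inf ub lb)).
near=> t; apply: ge_sup; first by exists (u t); exists t => /=.
move=> _ [s /= ts <-]; apply: Nc; rewrite /=; apply: leq_trans ts.
by near: t; exists N.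
Unshelve. all: by end_near. Qed.

Lemma limn_sup_lt_near (R : realType) (u : nat -> R) (c : R) :
  has_ubound (range u) -> has_lbound (range u) -> limn_sup u < c ->
  \forall t \near \oo, u t <= c.
Proof.
move=> ub lb uc; have su := cvg_sups_inf ub lb.
have /(cvgr_le _ su) : inf (range (sups u)) < c.
  by rewrite -(cvg_lim _ su).
apply: filterS => t; apply: le_trans.
by apply: ub_le_sup; [exact: has_ubound_sdrop|exists t => /=].
Qed.

Lemma limn_sup_ge0 (R : realType) (u : nat -> R) :
  has_ubound (range u) -> (forall t, 0 <= u t) -> 0 <= limn_sup u.
Proof.
move=> ub u0.
have lb : has_lbound (range u) by exists 0 => _ [t _ <-].
apply: limr_ge; first exact: (cvgP _ (cvg_sups_inf ub lb)).
apply: nearW => t; apply: (le_trans (u0 t)).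
by apply: ub_le_sup; [exact: has_ubound_sdrop|exists t => /=].
Qed.

(** * Duality for closed convex cones *)

Lemma trmx_continuous (T : topologicalType) (p q : nat) :
  continuous (fun B : 'M[T]_(p, q) => B^T).
Proof.
move=> B U /= [P PB PU]; exists (fun i j => P j i) => [i j|C PC].
  by have := PB j i; rewrite mxE.
by apply: PU => i j; rewrite mxE; exact: PC.
Qed.

(** The Euclidean norm squared: unlike the entrywise norm it makes a nearest
point satisfy a linear inequality. *)
Definition sqnorm (R : realType) (n : nat) (v : 'cV[R]_n) : R :=
  \sum_(i < n) v i 0 ^+ 2.

Lemma sqnorm_ge0 (R : realType) (n : nat) (v : 'cV[R]_n) : 0 <= sqnorm v.
Proof. by apply: sumr_ge0 => i _; exact: sqr_ge0. Qed.

Lemma sqnorm_eq0 (R : realType) (n : nat) (v : 'cV[R]_n) :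
  sqnorm v = 0 -> v = 0.
Proof.
move=> /psumr_eq0P v0; apply/matrixP => i j; rewrite ord1 mxE.
by apply/eqP; rewrite -sqrf_eq0 v0 // => k _; exact: sqr_ge0.
Qed.

Lemma norm_le_sqnorm (R : realType) (n : nat) (v : 'cV[R]_n) :
  `|v| <= sqnorm v + 1.
Proof.
apply: norm_le_entries => [|i j]; first by rewrite addr_ge0 ?sqnorm_ge0.
rewrite ord1; apply: (@le_trans _ _ (v i 0 ^+ 2 + 1)); last first.
  rewrite lerD2r /sqnorm (bigD1 i) //= lerDl.
  by apply: sumr_ge0 => k _; exact: sqr_ge0.
rewrite -[v i 0 ^+ 2]real_normK ?num_real //.
have := sqr_ge0 (`|v i 0| - 1); nra.
Qed.

Lemma sqnormDZ (R : realType) (n : nat) (v w : 'cV[R]_n) (t : R) :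
  sqnorm (v + t *: w) =
  sqnorm v + t * (2 * (v^T *m w) 0 0 + t * sqnorm w).
Proof.
rewrite mxE /sqnorm !mulr_sumr -big_split /= mulr_sumr -big_split /=.
by apply: eq_bigr => i _; rewrite !mxE; ring.
Qed.

Lemma sqnorm_trmx_continuous (R : realType) (n : nat) (y : 'cV[R]_n) :
  continuous (fun u : 'rV[R]_n => sqnorm (u^T - y)).
Proof.
apply: continuous_big => [|i _]; first exact: add_continuous.
rewrite (_ : (fun u : 'rV[R]_n => (u^T - y) i 0 ^+ 2) =
  (fun u : 'rV[R]_n => u 0 i - y i 0) \* (fun u : 'rV[R]_n => u 0 i - y i 0)).
  move=> u; apply: continuousM;
    by apply: continuousB; [exact: coord_continuous|exact: cst_continuous].
by apply/funext => u /=; rewrite !mxE expr2.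
Qed.

(** Only the points of K at least as close to y as the given point x compete,
and they lie in a box.  The compactness argument takes place in the space of row
vectors, through the transpose. *)
Lemma closed_nearest_point (R : realType) (n : nat) (K : set 'cV[R]_n)
    (x y : 'cV[R]_n) : closed K -> K x ->
  exists2 p, K p & forall v, K v -> sqnorm (p - y) <= sqnorm (v - y).
Proof.
move=> clK Kx; pose M := `|y| + (sqnorm (x - y) + 1).
pose box := [set u : 'rV[R]_n | forall i, `[- M, M]%classic (u ord0 i)].
have boxP v : sqnorm (v - y) <= sqnorm (x - y) -> box v^T.
  move=> vx i; rewrite /= in_itv /= mxE -ler_norml.
  apply: (le_trans (entry_le_norm _ _ _)).
  rewrite -[v](subrK y) addrC; apply: (le_trans (ler_normD _ _)).
  by rewrite lerD2l (le_trans (norm_le_sqnorm _)) // lerD2r.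
pose KT := (fun u : 'rV[R]_n => u^T) @^-1` K.
have cA : compact (box `&` KT).
  apply: compact_closedI.
    apply: (@rV_compact _ _ (fun=> `[- M, M]%classic)) => i.
    exact: segment_compact.
  by apply: preimage_closed clK => u _; exact: trmx_continuous.
have A0 : (box `&` KT) !=set0.
  by exists x^T; split; [exact: boxP|rewrite /KT /= trmxK].
have [u /set_mem[_ Ku] umin] := compact_EVT_min A0 cA
  (continuous_subspaceT (@sqnorm_trmx_continuous R n y)).
exists u^T => // v Kv.
have [vx|/ltW xv] := leP (sqnorm (v - y)) (sqnorm (x - y)).
  have /umin : v^T \in box `&` KT.
    by apply/mem_set; split; [exact: boxP|rewrite /KT /= trmxK].
  by rewrite trmxK.
apply: le_trans xv.
have /umin : x^T \in box `&` KT.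
  by apply/mem_set; split; [exact: boxP|rewrite /KT /= trmxK].
by rewrite trmxK.
Qed.

Lemma convex_cone_add (R : realType) (n : nat) (K : set 'cV[R]_n) u v :
  cone K -> @convex_set R 'cV[R]_n K -> K u -> K v -> K (u + v).
Proof.
move=> coK cvK Ku Kv.
have h : 0 <= (2^-1 : R) <= 1.
  by rewrite invr_ge0 ler0n invf_le1 ?ltr0n // ler1n.
have := cvK u v (Itv01 (andP h).1 (andP h).2) (mem_set Ku) (mem_set Kv).
have -> : conv (Itv01 (andP h).1 (andP h).2) (u : convex_lmodType 'cV[R]_n) v =
    2^-1 *: u + (1 - 2^-1) *: v by [].
move=> /set_mem /(coK 2 _ (ler0n _ _)).
rewrite scalerDr !scalerA mulrBr mulfV ?pnatr_eq0 // mulr1.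
by rewrite (_ : 2 - 1 = 1) ?scale1r //; ring.
Qed.

(** The form is the scalar product with p - y, for p the point of K nearest to
y.  Moving from p inside K, along a vector of K or towards 0, does not
decrease the distance to y, so the form is nonnegative on K and nonpositive at
p; it is then negative at y = p - (p - y). *)
Lemma cone_separation (R : realType) (n : nat) (K : set 'cV[R]_n) y :
  cone K -> closed K -> @convex_set R 'cV[R]_n K -> K !=set0 -> ~ K y ->
  exists2 l : 'rV[R]_n, forall v, K v -> 0 <= (l *m v) 0 0 & (l *m y) 0 0 < 0.
Proof.
move=> coK clK cvK [x Kx] nKy.
have [p Kp pmin] := closed_nearest_point y clK Kx.
(* First-order condition at the minimum p, in a direction w that stays in K. *)
have var w : (forall t, 0 < t -> t <= 1 -> K (p + t *: w)) ->
    0 <= ((p - y)^T *m w) 0 0.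
  set d := (_ *m w) 0 0 => Kw; rewrite leNgt; apply/negP => d0.
  have s0 := sqnorm_ge0 w.
  have sd0 : 0 < sqnorm w - d by rewrite subr_gt0 (lt_le_trans d0).
  (* With this t, 2 * d + t * sqnorm w <= d < 0, and t <= 1. *)
  pose t := - d / (sqnorm w - d).
  have t0 : 0 < t by rewrite divr_gt0 // oppr_gt0.
  have t1 : t <= 1 by rewrite ler_pdivrMr // mul1r lerDr.
  have := pmin _ (Kw t t0 t1).
  rewrite [p + _ - y]addrAC sqnormDZ -/d lerDl pmulr_rge0 //.
  have : t * (sqnorm w - d) = - d by rewrite mulfVK // gt_eqF.
  nra.
have pp : ((p - y)^T *m p) 0 0 <= 0.
  rewrite -oppr_ge0.
  have -> : - ((p - y)^T *m p) 0 0 = ((p - y)^T *m (- p)) 0 0.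
    by rewrite mulmxN [in RHS]mxE.
  apply: var => t t0 t1.
  have -> : p + t *: - p = (1 - t) *: p by rewrite scalerN scalerBl scale1r.
  by apply: coK => //; rewrite subr_ge0.
exists (p - y)^T => [v Kv|].
  by apply: var => t t0 t1; apply: convex_cone_add => //; apply: coK => //; exact: ltW.
have sq : ((p - y)^T *m (p - y)) 0 0 = sqnorm (p - y).
  by rewrite mxE; apply: eq_bigr => i _; rewrite mxE expr2.
have -> : ((p - y)^T *m y) 0 0 =
    ((p - y)^T *m p) 0 0 - ((p - y)^T *m (p - y)) 0 0.
  rewrite [in X in _ = _ - X]mulmxBr.
  by rewrite [in X in _ = _ - X]mxE [X in _ = _ - (_ + X)]mxE opprD opprK addNKr.
rewrite sq (le_lt_trans (lerD pp (lexx _))) // add0r oppr_lt0 lt_neqAle.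
rewrite sqnorm_ge0 andbT eq_sym; apply/eqP => /sqnorm_eq0/eqP.
by rewrite subr_eq0 => /eqP py; rewrite py in Kp.
Qed.

(** Among the finite families of forms nonnegative on K, one of maximal rank
spans: otherwise all its forms vanish at some x != 0, one of x and -x is outside
K because K contains no line, and separating that point from K gives a form
that raises the rank. *)
Lemma dual_cone_spans (R : realType) (n : nat) (K : set 'cV[R]_n) :
  cone K -> closed K -> @convex_set R 'cV[R]_n K -> K !=set0 ->
  ~ contains_line K ->
  exists r (L : 'M[R]_(r, n)),
    row_full L /\ forall v, K v -> forall i, 0 <= (L *m v) i 0.
Proof.
move=> coK clK cvK K0 nlK.
pose dual r (L : 'M[R]_(r, n)) := forall v, K v -> forall i, 0 <= (L *m v) i 0.
pose P d := `[< exists r (L : 'M[R]_(r, n)), dual r L /\ \rank L = d >].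
have exP : exists d, P d.
  exists 0%N; apply/asboolP; exists 0%N, 0; split; last exact: mxrank0.
  by move=> v _ [].
have ubP d : P d -> (d <= n)%N.
  by move=> /asboolP[r [L [_ <-]]]; exact: rank_leq_col.
have [d /asboolP[r [L [dL rL]]] dmax] := ex_maxnP exP ubP.
exists r, L; split => //; apply: contraPT nlK => nfull nlK.
have [x x0 Lx] : exists2 x : 'cV[R]_n, x != 0 & L *m x = 0.
  move: nfull; rewrite -cokermx_eq0 => /matrix0Pn[i [j Cij]].
  exists (col j (cokermx L)).
    by apply: contraNneq Cij => /colP/(_ i); rewrite !mxE => ->.
  by rewrite colE mulmxA mulmx_coker mul0mx.
have [y nKy Ly] : exists2 y, ~ K y & L *m y = 0.
  have [Kx|nKx] := pselect (K x); last by exists x.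
  have [Kx'|nKx] := pselect (K (- x)); last by exists (- x); rewrite ?mulmxN ?Lx ?oppr0.
  exfalso; apply: nlK; exists 0, x; split => // t; rewrite add0r.
  have [t0|/ltW t0] := leP 0 t; first exact: coK.
  by rewrite -[t *: x]opprK -scaleNr -scalerN; apply: coK; rewrite ?oppr_ge0.
have [l dl ly] := cone_separation coK clK cvK K0 nKy.
have : (L < col_mx l L)%MS.
  rewrite ltmxE; apply/andP; split.
    by have := submx_refl (col_mx l L); rewrite col_mx_sub => /andP[].
  rewrite col_mx_sub negb_and; apply/orP; left.
  apply/negP => /submxP[D lD]; move: ly.
  by rewrite lD -mulmxA Ly mulmx0 mxE ltxx.
rewrite ltmxErank rL => /andP[_]; rewrite ltnNge => /negP; apply.
apply: dmax; apply/asboolP; exists (1 + r)%N, (col_mx l L); split => // v Kv i.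
rewrite mul_col_mx mxE; case: splitP => j _; last exact: dL.
by rewrite ord1; exact: dl.
Qed.

(** On K the norm is at most c times l, where l is the sum of a spanning family
of nonnegative forms.  For a matrix B preserving K, the column B e_j is a
multiple of the difference of B (x + w) and B (x - w), with w a small multiple
of e_j; both are in K, and the sum of their l-values is 2 * l B x. *)
Lemma cone_norm_bound (R : realType) (n : nat) (K : set 'cV[R]_n) :
  proper_cone K ->
  exists (l : 'rV[R]_n) (x : 'cV[R]_n) (c : R), 0 < c /\
    forall B : 'M[R]_n, mulmx B @` K `<=` K ->
      `|B| <= c * (l *m B *m x) 0 0.
Proof.
move=> [coK clK cvK [x Kx] nlK].
have K0 : K !=set0 by exists x; exact: interior_subset.
have [r [L [fL dL]]] := dual_cone_spans coK clK cvK K0 nlK.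
pose l : 'rV[R]_n := const_mx 1 *m L.
have lE v : (l *m v) 0 0 = \sum_i (L *m v) i 0.
  by rewrite /l -mulmxA mxE; apply: eq_bigr => i _; rewrite mxE mul1r.
pose c := r%:R * `|pinvmx L| + 1.
have c0 : 0 < c by rewrite ltr_wpDl // mulr_ge0.
have lK v : K v -> `|v| <= c * (l *m v) 0 0.
  move=> Kv; rewrite -{1}[v]mul1mx -(mulVpmx fL) -mulmxA.
  have Lv : `|L *m v| <= (l *m v) 0 0.
    apply: norm_le_entries => [|i j].
      by rewrite lE sumr_ge0 // => i _; exact: dL.
    rewrite ord1 ger0_norm ?dL // lE (bigD1 i) //= lerDl.
    by rewrite sumr_ge0 // => k _; exact: dL.
  apply: (le_trans (norm_mulmx_le _ _)).
  by rewrite ler_pM ?mulr_ge0 // lerDl.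
have [e e0 xK] : exists2 e : R, 0 < e &
    forall w : 'cV[R]_n, `|w| <= e -> K (x + w).
  move/nbhs_ballP : Kx => [e /= e0 xK]; exists (e / 2) => [|w we].
    by rewrite divr_gt0.
  apply: xK; rewrite mx_norm_ball /ball_ /= opprD addNKr normrN.
  by rewrite (le_lt_trans we) // ltr_pdivrMr // ltr_pMr // ltr1n.
exists l, x, (c / e); split; first exact: divr_gt0.
move=> B BK.
have KB v : K v -> K (B *m v) by move=> Kv; apply: BK; exists v.
have lB0 : 0 <= (l *m B *m x) 0 0.
  rewrite -mulmxA lE sumr_ge0 // => i _; apply: dL; apply: KB.
  exact: interior_subset.
apply: norm_le_entries => [|i j].
  by rewrite mulr_ge0 // divr_ge0 ?(ltW c0) ?(ltW e0).
pose w : 'cV[R]_n := e *: delta_mx j 0.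
have we : `|w| <= e.
  apply: norm_le_entries => [|a b]; first exact: ltW.
  rewrite !mxE normrM (gtr0_norm e0) ler_piMr // ?(ltW e0) //.
  by case: (_ && _); rewrite ?normr1 ?normr0.
have Kp := lK _ (KB _ (xK w we)).
have Km : `|B *m (x - w)| <= c * (l *m (B *m (x - w))) 0 0.
  by apply: lK; apply: KB; apply: xK; rewrite normrN.
have Bw : (B *m w) i 0 = e * B i j.
  rewrite /w -scalemxAr mxE -colE mxE.
  by [].
have l2 : (l *m (B *m (x + w))) 0 0 + (l *m (B *m (x - w))) 0 0 =
    2 * (l *m B *m x) 0 0.
  rewrite !mulmxDr mulmxN mulmxN mulmxA [X in X + _]mxE [X in _ + X]mxE.
  by rewrite [X in _ + (_ + X)]mxE; ring.
have ent : 2 * (e * `|B i j|) <= `|B *m (x + w)| + `|B *m (x - w)|.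
  apply: le_trans (lerD (entry_le_norm _ i 0) (entry_le_norm _ i 0)).
  apply: le_trans (ler_normB _ _).
  rewrite -[e in leLHS](gtr0_norm e0) -normrM -[2 in leLHS]ger0_norm //.
  rewrite -normrM -Bw; rewrite !mulmxDr mulmxN.
  rewrite [X in _ <= `|X - _|]mxE [X in _ <= `|_ - X|]mxE [X in _ - (_ + X)]mxE.
  by rewrite le_eqVlt; apply/orP; left; apply/eqP; congr (`|_|); ring.
rewrite mulrAC ler_pdivlMr //.
have := le_trans ent (lerD Kp Km); rewrite -mulrDr l2.
lra.
Qed.

(** * Words against powers of the Kronecker sum *)

Definition max_word_root (R : realType) (n m : nat) (A : 'I_m -> 'M[R]_n)
    (t : nat) : R :=
  \big[Num.max/0]_(s : t.-tuple 'I_m) (`|word_prod A s| `^ t%:R^-1).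

Lemma max_word_root_ge0 (R : realType) (n m : nat) (A : 'I_m -> 'M[R]_n) t :
  0 <= max_word_root A t.
Proof. by rewrite /max_word_root; elim/big_ind: _ => // a b a0 b0; rewrite le_max a0. Qed.

Lemma norm_word_prod_le (R : realType) (n m t : nat) (A : 'I_m -> 'M[R]_n)
    (s : t.+1.-tuple 'I_m) : `|word_prod A s| <= max_word_root A t.+1 ^+ t.+1.
Proof.
rewrite -[leLHS](powR_root_exp t) //.
rewrite ler_pXn2r ?nnegrE ?powR_ge0 ?max_word_root_ge0 //.
exact: (le_bigmax_cond _
  (fun s : t.+1.-tuple 'I_m => `|word_prod A s| `^ t.+1%:R^-1)).
Qed.

Lemma norm_kron_power_sum_expr_le (R : realType) (n m k t : nat)
    (A : 'I_m -> 'M[R]_n) :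
  `|kron_power_sum A k.+1 ^+ t.+1| <=
  (m%:R * max_word_root A t.+1 ^+ k.+1) ^+ t.+1.
Proof.
rewrite kron_power_sum_expr; apply: (le_trans (ler_norm_sum _ _ _)).
have card_words : #|{: t.+1.-tuple 'I_m}| = (m ^ t.+1)%N.
  by rewrite card_tuple card_ord.
rewrite exprMn -natrX -card_words mulr_natl -sumr_const.
apply: ler_sum => s _; apply: (le_trans (norm_ntensmx_le _ _)).
rewrite -exprM mulnC exprM ler_pXn2r ?nnegrE ?exprn_ge0 ?max_word_root_ge0 //.
exact: norm_word_prod_le.
Qed.

Lemma word_prod_preserves (R : realType) (n m t : nat) (A : 'I_m -> 'M[R]_n)
    (K : set 'cV[R]_n) (s : t.-tuple 'I_m) :
  (forall i, mulmx (A i) @` K `<=` K) -> mulmx (word_prod A s) @` K `<=` K.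
Proof.
move=> AK; rewrite /word_prod.
elim/big_ind: _ => [_ [v Kv <-]|B C BK CK _ [v Kv <-]|i _]; last exact: AK.
  by rewrite mul1mx.
by rewrite -mulmxA; apply: BK; exists (C *m v) => //; apply: CK; exists v.
Qed.

(** With l and x the form and the vector of [cone_norm_bound], the numbers
l A_s x are nonnegative, so each of their k.+1-st powers is at most the sum of
these powers over all words s of length t, and that sum is a linear function of
the t-th power of the Kronecker sum. *)
Lemma norm_word_prod_le_kron (R : realType) (n m k : nat)
    (A : 'I_m -> 'M[R]_n) (K : set 'cV[R]_n) :
  proper_cone K -> (forall i, mulmx (A i) @` K `<=` K) ->
  exists2 C : R, 0 < C & forall t (s : t.-tuple 'I_m),
    `|word_prod A s| ^+ k.+1 <= C * `|kron_power_sum A k.+1 ^+ t|.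
Proof.
move=> pK AK; have [l [x [c [c0 lB]]]] := cone_norm_bound pK.
pose lk := l ^t k.+1; pose xk := x ^t k.+1; pose N : R := (n ^ k.+1)%:R.
pose D := N * (N * `|lk|) * `|xk|.
have D0 : 0 <= D by rewrite !mulr_ge0.
exists (c ^+ k.+1 * (D + 1)) => [|t s].
  by rewrite mulr_gt0 ?exprn_gt0 // ltr_wpDl.
have lw0 t' (s' : t'.-tuple 'I_m) : 0 <= (l *m word_prod A s' *m x) 0 0.
  rewrite -(pmulr_rge0 _ c0); apply: le_trans (lB _ _) => //.
  exact: word_prod_preserves.
(* The Kronecker power of a 1 x 1 matrix has size 1 ^ k.+1, which is 1 only
   propositionally; i is its index. *)
have ik : (0 < 1 ^ k.+1)%N by rewrite exp1n.
pose i := Ordinal ik.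
have lwE (s' : t.-tuple 'I_m) : (lk *m (word_prod A s') ^t k.+1 *m xk) i i =
    (l *m word_prod A s' *m x) 0 0 ^+ k.+1.
  by rewrite -!ntensmx_mul ntensmx_dim1.
apply: (@le_trans _ _ (c ^+ k.+1 * (l *m word_prod A s *m x) 0 0 ^+ k.+1)).
  rewrite -exprMn ler_pXn2r ?nnegrE ?mulr_ge0 // ?(ltW c0) //.
  by apply: lB; exact: word_prod_preserves.
rewrite -mulrA ler_pM2l ?exprn_gt0 //.
apply: (@le_trans _ _ (D * `|kron_power_sum A k.+1 ^+ t|)); last first.
  by rewrite ler_wpM2r // lerDl.
apply: (@le_trans _ _ ((lk *m kron_power_sum A k.+1 ^+ t *m xk) i i)).
  rewrite kron_power_sum_expr mulmx_sumr mulmx_suml summxE.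
  under eq_bigr do rewrite lwE.
  by rewrite (bigD1 s) //= lerDl sumr_ge0 // => s' _; rewrite exprn_ge0.
apply: (le_trans (ler_norm _)); apply: (le_trans (entry_le_norm _ _ _)).
apply: (le_trans (norm_mulmx_le _ _)).
rewrite /D [leRHS]mulrAC ler_wpM2r // -mulrA ler_wpM2l // norm_mulmx_le //.
Qed.

Lemma max_word_root_le (R : realType) (n m k t : nat) (A : 'I_m -> 'M[R]_n)
    (C : R) : 0 <= C ->
  (forall s : t.+1.-tuple 'I_m,
    `|word_prod A s| ^+ k.+1 <= C * `|kron_power_sum A k.+1 ^+ t.+1|) ->
  max_word_root A t.+1 ^+ k.+1 <=
  C `^ t.+1%:R^-1 * `|kron_power_sum A k.+1 ^+ t.+1| `^ t.+1%:R^-1.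
Proof.
move=> C0 wC; set y := leRHS; have y0 : 0 <= y by rewrite mulr_ge0 ?powR_ge0.
rewrite -[leRHS](powR_root_exp k y0).
rewrite ler_pXn2r ?nnegrE ?powR_ge0 ?max_word_root_ge0 //.
apply: bigmax_le => [|s _]; first exact: powR_ge0.
rewrite -[leLHS](powR_exp_root k) ?powR_ge0 //; apply: ler_root.
  by rewrite exprn_ge0 ?powR_ge0.
rewrite -powR_mulrn ?powR_ge0 // -powRrM mulrC powRrM powR_mulrn //.
by rewrite /y -powRM //; apply: ler_root => //; rewrite exprn_ge0.
Qed.

(** * The two inequalities and the limit *)

Lemma kron_sandwich (R : realType) (n m k : nat) (A : 'I_m -> 'M[R]_n)
    (K : set 'cV[R]_n) : (0 < m)%N ->
  proper_cone K -> (forall i, mulmx (A i) @` K `<=` K) ->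
  let r := spectral_radius (kron_power_sum A k.+1) `^ k.+1%:R^-1 in
  1 / m%:R `^ k.+1%:R^-1 * r <= joint_spectral_radius A
  /\ joint_spectral_radius A <= r.
Proof.
move=> m0 pK AK; set S := kron_power_sum A k.+1 => r.
have u0 t : 0 <= max_word_root A t by exact: max_word_root_ge0.
have rk : r ^+ k.+1 = spectral_radius S.
  by rewrite powR_root_exp // spectral_radius_ge0.
have r0 : 0 <= r by exact: powR_ge0.
have Sc := @spectral_radius_cvg _ _ S.
have upper e : 0 < e -> \forall t \near \oo, max_word_root A t <= r + e.
  move=> e0; have [C C0 wC] := norm_word_prod_le_kron k pK AK.
  have CSc : C `^ t%:R^-1 * `|S ^+ t| `^ t%:R^-1 @[t --> \oo] -->
      spectral_radius S.
    by rewrite -[X in _ --> X]mul1r; apply: cvgM Sc; exact: cvg_powR_inv.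
  have Sre : spectral_radius S < (r + e) ^+ k.+1.
    by rewrite -rk ltr_pXn2r ?nnegrE ?addr_ge0 ?(ltW e0) // ltrDl.
  have near1 := cvgr_le _ CSc _ Sre.
  have near2 : \forall t \near \oo, (0 < t)%N by exists 1%N.
  near=> t; have St : C `^ t%:R^-1 * `|S ^+ t| `^ t%:R^-1 <= (r + e) ^+ k.+1.
    by near: t; exact: near1.
  have t0 : (0 < t)%N by near: t; exact: near2.
  case: (t) t0 St => [//|p] _ St.
  rewrite -(@ler_pXn2r _ k.+1) ?nnegrE ?addr_ge0 ?(ltW e0) //.
  by apply: le_trans St; apply: max_word_root_le => //; exact: ltW.
have [ub _] := limn_sup_le_near u0 (upper 1 ltr01).
have lb : has_lbound (range (max_word_root A)) by exists 0 => _ [t _ <-].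
have j0 : 0 <= joint_spectral_radius A by exact: limn_sup_ge0.
split=> //; last first.
  by apply/ler_addgt0Pr => e e0; have [] := limn_sup_le_near u0 (upper e e0).
apply/ler_addgt0Pr => e e0.
have je : 0 <= joint_spectral_radius A + e by rewrite addr_ge0 // ltW.
have mk0 : (0 : R) < m%:R `^ k.+1%:R^-1 by rewrite powR_gt0 // ltr0n.
have Sle : spectral_radius S <= m%:R * (joint_spectral_radius A + e) ^+ k.+1.
  rewrite /spectral_radius; apply: limr_le; first exact: (cvgP _ Sc).
  have near1 : \forall t \near \oo, max_word_root A t <= joint_spectral_radius A + e.
    by apply: (limn_sup_lt_near ub lb); rewrite ltrDl.
  have near2 : \forall t \near \oo, (0 < t)%N by exists 1%N.
  near=> t; have ut : max_word_root A t <= joint_spectral_radius A + e.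
    by near: t; exact: near1.
  have t0 : (0 < t)%N by near: t; exact: near2.
  case: (t) t0 ut => [//|p] _ ut.
  have y0 : 0 <= m%:R * (joint_spectral_radius A + e) ^+ k.+1.
    by rewrite mulr_ge0 ?exprn_ge0.
  rewrite -[leRHS](powR_exp_root p y0); apply: ler_root => //.
  apply: (le_trans (norm_kron_power_sum_expr_le _ _ _)).
  rewrite ler_pXn2r ?nnegrE ?mulr_ge0 ?exprn_ge0 //.
  by rewrite ler_wpM2l // ler_pXn2r ?nnegrE.
rewrite div1r mulrC ler_pdivrMr //.
rewrite -[leRHS](powR_exp_root k) ?mulr_ge0 ?(ltW mk0) //.
apply: ler_root; first exact: spectral_radius_ge0.
by rewrite exprMn powR_root_exp ?ler0n // mulrC.
Unshelve. all: by end_near. Qed.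

Theorem theorem3 (R : realType) (n m : nat) (A : 'I_m -> 'M[R]_n)
    (hm : (0 < m)%N)
    (hA : exists K : set 'cV[R]_n,
        proper_cone K /\ forall i : 'I_m, mulmx (A i) @` K `<=` K) :
  (forall k : nat, (1 <= k)%N ->
     1 / m%:R `^ k%:R^-1 * spectral_radius (kron_power_sum A k) `^ k%:R^-1
       <= joint_spectral_radius A
     /\ joint_spectral_radius A
       <= spectral_radius (kron_power_sum A k) `^ k%:R^-1)
  /\ (fun k : nat => spectral_radius (kron_power_sum A k) `^ k%:R^-1) @ \oo
       --> joint_spectral_radius A.
Proof.
have [K [pK AK]] := hA.
have bounds k : (1 <= k)%N ->
    1 / m%:R `^ k%:R^-1 * spectral_radius (kron_power_sum A k) `^ k%:R^-1
      <= joint_spectral_radius A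
    /\ joint_spectral_radius A
      <= spectral_radius (kron_power_sum A k) `^ k%:R^-1.
  by case: k => [//|k] _; exact: (kron_sandwich k hm pK AK).
split=> //.
have mj : m%:R `^ k%:R^-1 * joint_spectral_radius A @[k --> \oo] -->
    joint_spectral_radius A.
  rewrite -[X in _ --> X]mul1r; apply: cvgMr_tmp; apply: cvg_powR_inv.
  by rewrite ltr0n.
apply: (squeeze_cvgr _ (cvg_cst (joint_spectral_radius A)) mj).
exists 1%N => // k /= k0; have [lo up] := bounds k k0; rewrite up /=.
by rewrite -ler_pdivrMl ?powR_gt0 ?ltr0n // -div1r.
Qed.
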